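(* There exists a universal constant $C<\infty$ such that the following holds. Let $\mathcal{X}\subseteq\mathbb{R}^d$ be a closed convex set containing $x_0=0$, let $\delta\in(0,\tfrac12)$, $L,R>0$, $T\in\mathbb{N}$, and let $(f,P)\in\mathcal{I}_{\mathsf{SM\text{-}Lip}}^{L,R}$. Let $x_0,\dots,x_{T-1}$ be the iterates of clipped SGD started at $x_0$ with step size $\eta=\frac{R}{L\sqrt T}$ and clipping parameter $G_{\mathrm{clip}}=\frac{L\sqrt T}{\sqrt{\log(1/\delta)}}$, run on i.i.d. samples $S_1,S_2,\dots\sim P$, and let $\bar x_T=\frac1T\sum_{t=0}^{T-1}x_t$. Then, with probability at least $1-\delta$, $$F_{f,P}(\bar x_T)-\inf_{x\in\mathcal{X}}F_{f,P}(x)\;\le\; C\,\frac{LR}{\sqrt T}\sqrt{\log\frac1\delta}.$$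
   Context: $\|\cdot\|$ is the Euclidean norm and $\log$ the natural logarithm. A stochastic optimization instance is a pair $(f,P)$, where $P$ is a probability distribution on a sample space $\mathcal{S}$ and $f:\mathcal{X}\times\mathcal{S}\to\mathbb{R}$ is such that $F_{f,P}(x):=\mathbb{E}_{S\sim P}f(x;S)$ is well defined and finite for all $x\in\mathcal{X}$. Let $X^\star_{f,P}:=\arg\min_{x\in\mathcal{X}}F_{f,P}(x)$; the norm of a set is the infimum of the norms of its elements ($\infty$ for the empty set). Each convex sample function $f(\cdot;s)$ comes with a (measurable) subgradient selection $\nabla f(x;s)\in\partial f(x;s)$. The class $\mathcal{I}_{\mathsf{SM\text{-}Lip}}^{L,R}$ consists of the instances such that $f(\cdot;s)$ is convex for all $s\in\mathcal{S}$, $\mathbb{E}_{S\sim P}\|\nabla f(x;S)\|^2\le L^2$ for all $x\in\mathcal{X}$, and $\|X^\star_{f,P}\|\le R$. Clipped SGD with step size $\eta$, clipping parameter $G_{\mathrm{clip}}$ and initial point $x_0$ is the recursion $$x_{t+1}=\Pi_{\mathcal{X}'}(x_t-\eta\bar g_t),\qquad \bar g_t:=\frac{g_t}{\max\{1,\|g_t\|/G_{\mathrm{clip}}\}},\qquad g_t=\nabla f(x_t;S_{t+1}),$$ where $\Pi_{\mathcal{X}'}$ is the Euclidean projection onto $\mathcal{X}'=\mathcal{X}\cap\{x:\|x-x_0\|\le R\}$. *)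

(* Defs.v *)
From HB Require Import structures.
From mathcomp Require Import all_boot all_order all_algebra finmap.
From mathcomp Require Import all_classical all_reals all_analysis.

Set Implicit Arguments.
Unset Strict Implicit.
Unset Printing Implicit Defensive.

Import Order.TTheory GRing.Theory Num.Theory.
Import numFieldNormedType.Exports.

Local Open Scope classical_set_scope.
Local Open Scope ring_scope.

Section euclidean.
Context {R : realType} {n : nat}.
Implicit Types (u v x y z : 'rV[R]_n) (A : set 'rV[R]_n).

Definition dotrv u v : R := \sum_(i < n) u 0 i * v 0 i.

(* The library norm on row vectors is the sup norm; it induces the same
   topology, so [closed] and [open] keep their Euclidean meaning. *)
Definition enorm u : R := Num.sqrt (dotrv u u).

(* +oo when A is empty. *)
Definition set_enorm A : \bar R := ereal_inf [set (enorm x)%:E | x in A].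

(* Unique for A nonempty, closed and convex; 0 if there is no nearest point. *)
Definition eproj A z : 'rV[R]_n :=
  xget 0 [set p | A p /\ forall y, A y -> enorm (z - p) <= enorm (z - y)].

Definition clip (G : R) v : 'rV[R]_n := (Num.max 1 (enorm v / G))^-1 *: v.

(* Subdifferential at x of h viewed as a function on A only. *)
Definition subdifferential A (h : 'rV[R]_n -> R) x : set 'rV[R]_n :=
  [set v | forall y, A y -> h x + dotrv v (y - x) <= h y].

End euclidean.

Notation borel_rV R n := (g_sigma_algebraType (@open 'rV[R]_n)).

Section stochastic_optimization.
Context {R : realType} {n : nat} {dS : measure_display} {S : measurableType dS}.
Implicit Types (X : set 'rV[R]_n) (f : 'rV[R]_n -> S -> R)
  (g : 'rV[R]_n -> S -> 'rV[R]_n) (P : probability S R).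

Definition risk f P (x : 'rV[R]_n) : R := fine ('E_P[f x])%E.

Definition argmin_risk X f P : set 'rV[R]_n :=
  [set x | X x /\ forall y, X y -> risk f P x <= risk f P y].

(* Here and below f and g are total functions, but only their values on X
   matter. *)
Definition is_instance X f P : Prop :=
  forall x, X x -> P.-integrable setT (EFin \o f x).

(* Joint measurability in (x, s), so that the iterates of a stochastic
   subgradient method are random variables. *)
Record is_subgradient_selection X f g : Prop := IsSubgradientSelection {
  selection_subgradient : forall x s, X x -> subdifferential X (f ^~ s) x (g x s);
  selection_measurable :
    @measurable_fun _ _ (borel_rV R n * S)%type (borel_rV R n)
      (X `*` setT) (fun z => g z.1 z.2) }.

Record SM_Lip X (L r : R) f P g : Prop := IsSMLip {
  SM_Lip_instance : is_instance X f P;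
  SM_Lip_convex : forall s,
    convex_function (X : set (convex_lmodType 'rV[R]_n)) (f ^~ s);
  SM_Lip_selection : is_subgradient_selection X f g;
  SM_Lip_moment : forall x, X x ->
    ('E_P[fun s => (enorm (g x s) ^+ 2)%R] <= (L ^+ 2)%:E)%E;
  SM_Lip_argmin : (set_enorm (argmin_risk X f P) <= r%:E)%E }.

(* s t is the sample used to compute the iterate of index t.+1. *)
Fixpoint clipped_sgd X (r eta G : R) g (x0 : 'rV[R]_n) (s : nat -> S) (t : nat)
    : 'rV[R]_n :=
  if t is t'.+1 then
    let x := clipped_sgd X r eta G g x0 s t' in
    eproj (X `&` [set y | enorm (y - x0) <= r])
      (x - eta *: clip G (g x (s t')))
  else x0.

End stochastic_optimization.

Section iid.
Context {R : realType} {dO dS : measure_display}.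
Context {Omega : measurableType dO} {S : measurableType dS}.

Definition mutually_independent (Q : probability Omega R)
    (xi : nat -> {RV Q >-> S}) : Prop :=
  forall (J : {fset nat}) (A : nat -> set S),
    (forall i, i \in J -> measurable (A i)) ->
    (Q (\bigcap_(i in [set` J]) (xi i @^-1` A i)) =
     \prod_(i <- J) Q (xi i @^-1` A i))%E.

Definition iid (Q : probability Omega R) (P : probability S R)
    (xi : nat -> {RV Q >-> S}) : Prop :=
  mutually_independent xi /\
  forall i A, measurable A -> distribution Q (xi i) A = P A.

End iid.

(* Main.v *)
Require Import Defs.
From HB Require Import structures.
From mathcomp Require Import all_boot all_order all_algebra finmap.
From mathcomp Require Import all_classical all_reals all_analysis.
From mathcomp Require Import measurable_realfun.
From mathcomp Require Import ring lra.

Set Implicit Arguments.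
Unset Strict Implicit.
Unset Printing Implicit Defensive.

Import Order.TTheory GRing.Theory Num.Theory.
Import numFieldNormedType.Exports.

Local Open Scope classical_set_scope.
Local Open Scope ring_scope.

(** Fix [y] in the domain with [|y| <= r].  Nonexpansiveness of the projection
    telescopes to [sum (c_t . (x_t - y) - eta/2 |c_t|^2) <= |x_0 - y|^2 / (2 eta)]
    for the clipped subgradients [c_t], so the regret
    [sum (F x_t - F y)] is at most a constant plus the sum of
    [U_t = F x_t - F y - c_t . (x_t - y) + eta/2 |c_t|^2].  Clipping bounds
    [lam U_t] up to its predictable part by 1 for [lam] of order [1 / (r G)], and
    [exp z <= 1 + z + 2 z^2] for [z <= 1], together with the subgradient
    inequality and the bias bound [|g - c| <= |g|^2 / G], shows that the
    conditional expectation of [exp (lam U_t)] is at most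
    [exp (3 ln (1 / delta) / T)].  Hence [E exp (lam sum U_t) <= delta^-3], the
    Chernoff bound controls [sum U_t], and Jensen's inequality concludes.  This
    replaces separate Freedman bounds for the martingale and the squared norms
    by a single supermartingale.

    The conditional step is Tonelli's theorem on the product of [Omega], with
    the sigma-algebra of the past samples, and the sample space. *)

(** * Euclidean geometry *)

Section euclidean_norm.
Context {R : realType} {n : nat}.
Implicit Types (u v w : 'rV[R]_n) (a : R).

Lemma dotrvC u v : dotrv u v = dotrv v u.
Proof. by apply: eq_bigr => i _; rewrite mulrC. Qed.

Lemma dotrvDl u v w : dotrv (u + v) w = dotrv u w + dotrv v w.
Proof. by rewrite /dotrv -big_split; apply: eq_bigr => i _; rewrite mxE mulrDl. Qed.

Lemma dotrvZl a u v : dotrv (a *: u) v = a * dotrv u v.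
Proof. by rewrite /dotrv mulr_sumr; apply: eq_bigr => i _; rewrite mxE mulrA. Qed.

Lemma dotrvNl u v : dotrv (- u) v = - dotrv u v.
Proof. by rewrite -scaleN1r dotrvZl mulN1r. Qed.

Lemma dotrvBl u v w : dotrv (u - v) w = dotrv u w - dotrv v w.
Proof. by rewrite dotrvDl dotrvNl. Qed.

Lemma dotrvDr u v w : dotrv u (v + w) = dotrv u v + dotrv u w.
Proof. by rewrite !(dotrvC u) dotrvDl. Qed.

Lemma dotrvZr a u v : dotrv u (a *: v) = a * dotrv u v.
Proof. by rewrite !(dotrvC u) dotrvZl. Qed.

Lemma dotrvBr u v w : dotrv u (v - w) = dotrv u v - dotrv u w.
Proof. by rewrite !(dotrvC u) dotrvBl. Qed.

Lemma dotrv0r u : dotrv u 0 = 0.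
Proof. by rewrite -(scale0r 0) dotrvZr mul0r. Qed.

Lemma dotrv_ge0 u : 0 <= dotrv u u.
Proof. by apply: sumr_ge0 => i _; rewrite -expr2 sqr_ge0. Qed.

Lemma enorm_ge0 u : 0 <= enorm u.
Proof. exact: sqrtr_ge0. Qed.

Lemma enorm_sqr u : enorm u ^+ 2 = dotrv u u.
Proof. by rewrite sqr_sqrtr// dotrv_ge0. Qed.

Lemma enormZ a u : enorm (a *: u) = `|a| * enorm u.
Proof.
by rewrite /enorm dotrvZl dotrvZr mulrA -expr2 sqrtrM ?sqr_ge0// sqrtr_sqr.
Qed.

Lemma enorm0 : enorm (0 : 'rV[R]_n) = 0.
Proof. by rewrite -(scale0r 0) enormZ normr0 mul0r. Qed.

Lemma enormN u : enorm (- u) = enorm u.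
Proof. by rewrite -scaleN1r enormZ normrN1 mul1r. Qed.

Lemma enormC u v : enorm (u - v) = enorm (v - u).
Proof. by rewrite -enormN opprB. Qed.

Lemma abs_coord_le_enorm u i : `|u 0 i| <= enorm u.
Proof.
rewrite -sqrtr_sqr ler_wsqrtr// [leRHS](bigD1 i)//= -expr2 lerDl.
by apply: sumr_ge0 => j _; rewrite -expr2 sqr_ge0.
Qed.

Lemma enorm_eq0 u : enorm u = 0 -> u = 0.
Proof.
move=> u0; apply/rowP => i; rewrite mxE; apply/eqP.
by rewrite -normr_le0 -u0 abs_coord_le_enorm.
Qed.

(** Transfers Euclidean estimates to the topology of the library, whose norm is the sup norm. *)
Lemma norm_le_enorm u : `|u| <= enorm u.
Proof.
rewrite [leLHS]/Num.norm/= mx_normrE; apply/bigmax_leP; split=> [|[i j] _ /=].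
  exact: enorm_ge0.
by rewrite ord1 abs_coord_le_enorm.
Qed.

(** Cauchy-Schwarz: the squared norm of [enorm v *: u - enorm u *: v] is nonnegative; expand it and
    divide by [2 * enorm u * enorm v]. *)
Lemma dotrv_le u v : dotrv u v <= enorm u * enorm v.
Proof.
have [/eqP|a0] := eqVneq (enorm u) 0.
  by move/eqP/enorm_eq0 ->; rewrite dotrvC dotrv0r enorm0 mul0r.
have [/eqP|b0] := eqVneq (enorm v) 0.
  by move/eqP/enorm_eq0 ->; rewrite dotrv0r enorm0 mulr0.
have := dotrv_ge0 (enorm v *: u - enorm u *: v).
rewrite !(dotrvBl, dotrvBr, dotrvZl, dotrvZr) (dotrvC v u) -!enorm_sqr.
have {a0} : 0 < enorm u by rewrite lt_def a0 enorm_ge0.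
have {b0} : 0 < enorm v by rewrite lt_def b0 enorm_ge0.
move: (enorm u) (enorm v) (dotrv u v) => a b c b0 a0 H.
have ab : 0 < a * b by rewrite mulr_gt0.
rewrite -(ler_pM2l ab); lra.
Qed.

Lemma abs_dotrv_le u v : `|dotrv u v| <= enorm u * enorm v.
Proof. by rewrite ler_norml lerNl -dotrvNl -(enormN u) !dotrv_le enormN dotrv_le. Qed.

Lemma ler_enormD u v : enorm (u + v) <= enorm u + enorm v.
Proof.
rewrite -ler_sqr ?nnegrE ?addr_ge0 ?enorm_ge0//.
rewrite enorm_sqr !(dotrvDl, dotrvDr) sqrrD !enorm_sqr (dotrvC v).
by have := dotrv_le u v; lra.
Qed.

Lemma ler_enormB u v : enorm (u - v) <= enorm u + enorm v.
Proof. by rewrite -(enormN v) ler_enormD. Qed.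

Lemma enorm_continuous : continuous (@enorm R n).
Proof.
have cdot : continuous (fun v : 'rV[R]_n => dotrv v v).
  rewrite /dotrv; elim: (index_enum _) => [|i s IH].
    rewrite (_ : (fun _ => _) = cst 0); first exact: cst_continuous.
    by apply/funext => v; rewrite big_nil.
  rewrite (_ : (fun _ => _) = (fun v : 'rV[R]_n => v 0 i * v 0 i +
    \sum_(j <- s) v 0 j * v 0 j)); last by apply/funext => v; rewrite big_cons.
  move=> u; apply: (@cvgD _ _ _ (nbhs u)); last exact: IH.
  by apply: (@cvgM _ _ (nbhs u)); exact: coord_continuous.
move=> u; apply: (@continuous_comp _ _ _ (fun v => dotrv v v) Num.sqrt).
  exact: cdot.
exact: sqrt_continuous.
Qed.

Lemma enormB_continuous u : continuous (fun v => enorm (u - v)).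
Proof.
move=> v; apply: (@continuous_comp _ _ _ (fun v => u - v)).
  by apply: (@cvgB _ _ _ (nbhs v)); [exact: cvg_cst|exact: cvg_id].
exact: enorm_continuous.
Qed.

End euclidean_norm.

(** * Projection onto a nonempty closed convex set *)

Section projection.
Context {R : realType} {n : nat}.
Variable (A : set 'rV[R]_n).
Hypotheses (clA : closed A) (cvA : convex_set (A : set (convex_lmodType 'rV[R]_n))).
Hypothesis (A0 : A !=set0).
Implicit Types (z y : 'rV[R]_n).

Lemma convex_setP (B : set 'rV[R]_n) (t : R) y z :
  convex_set (B : set (convex_lmodType 'rV[R]_n)) ->
  0 <= t <= 1 -> B y -> B z -> B (t *: y + (1 - t) *: z).
Proof.
move=> cvB /andP[t0 t1] By Bz.
by have := cvB y z (Itv01 t0 t1); rewrite !inE; apply.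
Qed.

Lemma eprojP z :
  A (eproj A z) /\ forall y, A y -> enorm (z - eproj A z) <= enorm (z - y).
Proof.
have [a Aa] := A0.
(* Points farther from [z] than a fixed [a] of [A] cannot be nearest, so the search is confined to
   [K]. This set is closed and bounded, hence compact, and the distance attains its minimum on
   it. *)
pose K := A `&` [set y | enorm (z - y) <= enorm (z - a)].
have clK : closed K.
  apply: closedI => //; apply: (@closed_comp _ _ (fun y => enorm (z - y))
    [set x | x <= enorm (z - a)]); last exact: closed_le.
  by move=> y _; exact: enormB_continuous.
have bK : bounded_set K.
  exists (enorm z + enorm (z - a)); split; first exact: num_real.
  move=> M HM y [_ /= Hy]; apply: le_trans (norm_le_enorm _) _.
  rewrite -(subKr z y); apply: le_trans (ler_enormB _ _) _.
  by apply: le_trans (ltW HM); rewrite lerD2l.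
have [||p] := @EVT_min_rV R n (fun y => enorm (z - y)) K _ (bounded_closed_compact bK clK).
- by exists a; split => /=.
- by apply: continuous_subspaceT => y; exact: enormB_continuous.
rewrite inE => -[Ap Hp] pmin.
apply: (@xgetPex _ 0 [set p | A p /\ forall y, A y -> enorm (z - p) <= enorm (z - y)]).
exists p; split=> // y Ay.
have [ya|/ltW ya] := leP (enorm (z - y)) (enorm (z - a)).
  by apply: pmin; rewrite inE; split.
by apply: le_trans ya; apply: pmin; rewrite inE; split=> /=.
Qed.

(** Variational inequality at the projection [p]: if the inner product [d] were positive, a small
    step from [p] towards [y] would stay in [A] and come closer to [z]. *)
Lemma dotrv_eproj_le0 z y : A y -> dotrv (z - eproj A z) (y - eproj A z) <= 0.
Proof.
move=> Ay; have [Ap pmin] := eprojP z.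
set p := eproj A z in Ap pmin *.
rewrite leNgt; apply/negP => d0.
set d := dotrv _ _ in d0; pose N := enorm (y - p) ^+ 2.
have N0 : 0 <= N by rewrite sqr_ge0.
have Nd : 0 < N + d by rewrite ltr_wpDl.
(* Minimality against a step of weight [t] gives [2 * d <= t * N]. This [t] lies in []0, 1]] even if
   [N = 0], and yields [2 * d * (N + d) <= d * N], absurd for [d > 0]. *)
pose t := d / (N + d).
have t0 : 0 < t by rewrite divr_gt0.
have t1 : t <= 1 by rewrite ler_pdivrMr// mul1r lerDr.
have := pmin _ (convex_setP (t := t) cvA _ Ay Ap).
rewrite t1 ltW// => /(_ isT).
have -> : z - (t *: y + (1 - t) *: p) = (z - p) - t *: (y - p).
  by apply/rowP => i; rewrite !mxE; ring.
rewrite -ler_sqr ?nnegrE ?enorm_ge0// !enorm_sqr.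
rewrite !(dotrvBl (z - p), dotrvBr _ (z - p)) !dotrvZl !dotrvZr.
rewrite -(enorm_sqr (y - p)) (dotrvC (y - p)) -/d -/N => H.
have {H} H : 2 * d <= t * N.
  rewrite -(ler_pM2l t0); lra.
have : 2 * d * (N + d) <= d * N.
  by move: H; rewrite /t mulrAC ler_pdivlMr.
have := mulr_gt0 d0 d0; have := mulr_ge0 (ltW d0) N0; nra.
Qed.

(** Adding the variational inequalities at the two projections [p] and [q] gives [enorm (p - q) ^+ 2
    <= dotrv (z - y) (p - q)]; Cauchy-Schwarz concludes. *)
Lemma eproj_nonexpansive z y : enorm (eproj A z - eproj A y) <= enorm (z - y).
Proof.
have [Ap _] := eprojP z; have [Aq _] := eprojP y.
have := dotrv_eproj_le0 z Aq; have := dotrv_eproj_le0 y Ap.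
set p := eproj A z; set q := eproj A y => H1 H2.
have {H1 H2} : enorm (p - q) ^+ 2 <= dotrv (z - y) (p - q).
  move: H1 H2; rewrite enorm_sqr !(dotrvBl, dotrvBr) (dotrvC p q); lra.
move=> /le_trans /(_ (dotrv_le _ _)).
have [->|pq0] := eqVneq (enorm (p - q)) 0; first by rewrite enorm_ge0.
by rewrite expr2 ler_pM2r// lt_def pq0 enorm_ge0.
Qed.

Lemma eproj_id y : A y -> eproj A y = y.
Proof.
move=> Ay; have [_ /(_ _ Ay)] := eprojP y.
rewrite subrr enorm0 => H; apply/esym/eqP; rewrite -subr_eq0; apply/eqP.
by apply: enorm_eq0; apply/eqP; rewrite eq_le H enorm_ge0.
Qed.

Lemma enorm_eproj_sub_le z y : A y -> enorm (eproj A z - y) <= enorm (z - y).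
Proof. by move=> Ay; rewrite -{1}(eproj_id Ay) eproj_nonexpansive. Qed.

Lemma eproj_continuous : continuous (eproj A).
Proof.
move=> z; apply/(@cvgrPdist_lt _ _ _ (nbhs z)) => /= e e0.
have : enorm (z - y) @[y --> z] --> enorm (z - z).
  exact: enormB_continuous.
rewrite subrr enorm0 => /(@cvgrPdist_lt _ _ _ (nbhs z)) /(_ _ e0).
apply: filterS => y; rewrite sub0r normrN => H.
apply: le_lt_trans (norm_le_enorm _) _.
apply: le_lt_trans (eproj_nonexpansive _ _) _.
exact: le_lt_trans (ler_norm _) H.
Qed.

End projection.

(** * Measurability of the iterates *)

Section borel_row_vectors.
Context {R : realType} {n : nat}.
Context {d : measure_display} {T : measurableType d}.
Implicit Types (D : set T) (h : T -> borel_rV R n).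

Lemma closed_borel_measurable (A : set 'rV[R]_n) :
  closed A -> measurable (A : set (borel_rV R n)).
Proof.
move=> clA; rewrite -(setCK A); apply: measurableC.
by apply: sub_sigma_algebra; exact: closed_openC.
Qed.

Lemma continuous_borel_measurable (phi : 'rV[R]_n -> R) :
  continuous phi -> measurable_fun setT (phi : borel_rV R n -> R).
Proof.
move=> /continuousP cphi; apply: (measurability _ (RGenOpens.measurableE R)).
move=> _ [_ [a [b ->] <-]]; rewrite setTI; apply: sub_sigma_algebra.
by apply: cphi; exact: interval_open.
Qed.

Lemma continuous_borel_measurable_rV (phi : 'rV[R]_n -> 'rV[R]_n) :
  continuous phi ->
  measurable_fun setT (phi : borel_rV R n -> borel_rV R n).
Proof.
move=> /continuousP cphi; apply: (@measurability _ _ _ (borel_rV R n) _ _ (@open 'rV[R]_n) (erefl _)).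
move=> _ [U oU <-]; rewrite setTI; apply: sub_sigma_algebra.
exact: cphi.
Qed.

Lemma measurable_coord D h i :
  measurable_fun D h -> measurable_fun D (fun t => (h t : 'rV[R]_n) 0 i).
Proof.
apply: (@measurableT_comp _ _ _ _ _ _ (fun v : borel_rV R n => (v : 'rV[R]_n) 0 i)).
by apply: continuous_borel_measurable; exact: coord_continuous.
Qed.

(** Open cubes with rational centre and radius [1 / (k + 1)]: a countable base of the topology. *)
Definition ratbox (p : 'rV[rat]_n * nat) : set 'rV[R]_n :=
  [set v | forall i, `|v 0 i - ratr (p.1 0 i)| < p.2.+1%:R^-1].

Lemma open_ratbox (U : set 'rV[R]_n) v : open U -> U v ->
  exists p, ratbox p v /\ ratbox p `<=` U.
Proof.
rewrite openE => oU /oU /nbhs_ballP[e /= e0 vU].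
have e20 : 0 < e / 2 by rewrite divr_gt0.
have [k] : exists k : nat, k.+1%:R^-1 < e / 2.
  have := near_infty_natSinv_lt (PosNum e20).
  by case=> k _ /(_ k (leqnn k)) /=; exists k.
move=> ke.
have k0 : (0 : R) < k.+1%:R^-1 by rewrite invr_gt0.
have qP i : exists q : rat, `|v 0 i - ratr q| < k.+1%:R^-1.
  have /rat_in_itvoo[q] : v 0 i - k.+1%:R^-1 < v 0 i + k.+1%:R^-1.
    by rewrite ltrBlDr -addrA ltrDl addr_gt0.
  rewrite in_itv/= => /andP[q1 q2]; exists q.
  by rewrite distrC ltr_distl q1 q2.
pose q : 'rV[rat]_n := \row_i projT1 (cid (qP i)).
have qE i : `|v 0 i - ratr (q 0 i)| < k.+1%:R^-1.
  by rewrite /q mxE; exact: (projT2 (cid (qP i))).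
exists (q, k); split=> [i|w wq]; first exact: qE.
apply: vU; split=> // i j; rewrite ord1 /ball/=.
have := wq j; have := qE j; rewrite /= => H1 H2.
rewrite -(subrK (ratr (q 0 j)) (v 0 j)) -addrA.
apply: le_lt_trans (ler_normD _ _) _; rewrite (distrC (ratr _)).
by rewrite (splitr e) ltrD// (lt_trans _ ke).
Qed.

(** An open set is the union of the countably many boxes inside it, and the preimage of a box is a
    finite intersection of conditions on coordinates. *)
Lemma measurable_rV D h :
  (forall i, measurable_fun D (fun t => (h t : 'rV[R]_n) 0 i)) ->
  measurable_fun D h.
Proof.
move=> mh mD; apply: (@measurability _ _ _ (borel_rV R n) _ _ (@open 'rV[R]_n) (erefl _)) => //.
move=> _ [U oU <-].
(* Boxes not contained in [U] contribute the empty set, so the union runs over the whole countable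
   type of indices. *)
pose F p := if pselect (ratbox p `<=` U) then D `&` h @^-1` (ratbox p) else set0.
have -> : D `&` h @^-1` U = \bigcup_p F p.
  apply/seteqP; split=> [t [Dt Uht]|t [p _]].
    have [p [pt pU]] := open_ratbox oU Uht.
    by exists p => //; rewrite /F; case: pselect.
  by rewrite /F; case: pselect => // pU [Dt /pU].
apply: countable_bigcupT_measurable; first exact: countableP.
move=> p; rewrite /F; case: pselect => [pU|_] /=; last exact: measurable0.
(* The index [None] keeps the intersection inside [D] even when [n = 0]. *)
have -> : D `&` h @^-1` ratbox p = \bigcap_i (if i is Some i then
  D `&` [set t | `|(h t : 'rV[R]_n) 0 i - ratr (p.1 0 i)| < p.2.+1%:R^-1] else D).
  apply/seteqP; split=> [t [Dt H] [i|] _|t H].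
    - by split=> //; exact: H.
    - by [].
  split=> [|i]; first exact: (H None I).
  by have [] := H (Some i) I.
apply: fin_bigcap_measurable => [|[i|] _]; [exact: finite_finset| |by []].
rewrite -preimage_true.
apply: measurable_fun_ltr => //.
apply: measurableT_comp; first exact: normr_measurable.
by apply: measurable_funB; [exact: mh|exact: measurable_cst].
Qed.

End borel_row_vectors.

Section measurable_row_vectors.
Context {R : realType} {n : nat}.
Context {d : measure_display} {T : measurableType d}.
Implicit Types (D : set T) (h k : T -> borel_rV R n).

Lemma measurable_enorm D h :
  measurable_fun D h -> measurable_fun D (fun t => enorm (h t)).
Proof.
apply: (@measurableT_comp _ _ _ _ _ _ (fun v : borel_rV R n => enorm v)).
by apply: continuous_borel_measurable; exact: enorm_continuous.
Qed.

Lemma measurable_rVD D h k : measurable_fun D h -> measurable_fun D k ->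
  measurable_fun D (fun t => (h t : 'rV[R]_n) + k t : borel_rV R n).
Proof.
move=> mh mk; apply: measurable_rV => i.
under eq_fun do rewrite mxE.
by apply: measurable_funD; exact: measurable_coord.
Qed.

Lemma measurable_rVZ D (a : T -> R) h :
  measurable_fun D a -> measurable_fun D h ->
  measurable_fun D (fun t => a t *: (h t : 'rV[R]_n) : borel_rV R n).
Proof.
move=> ma mh; apply: measurable_rV => i.
under eq_fun do rewrite mxE.
by apply: measurable_funM => //; exact: measurable_coord.
Qed.

Lemma measurable_rVB D h k : measurable_fun D h -> measurable_fun D k ->
  measurable_fun D (fun t => (h t : 'rV[R]_n) - k t : borel_rV R n).
Proof.
move=> mh mk; apply: measurable_rVD => //.
under eq_fun do rewrite -scaleN1r.
by apply: measurable_rVZ => //; exact: measurable_cst.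
Qed.

Lemma measurable_rV_sum D (I : Type) (s : seq I) (h : I -> T -> borel_rV R n) :
  (forall i, measurable_fun D (h i)) ->
  measurable_fun D (fun t => \sum_(i <- s) (h i t : 'rV[R]_n) : borel_rV R n).
Proof.
move=> mh; elim: s => [|i s IH].
  by under eq_fun do rewrite big_nil; exact: measurable_cst.
by under eq_fun do rewrite big_cons; exact: measurable_rVD.
Qed.

Lemma measurable_sumr D (I : Type) (s : seq I) (h : I -> T -> R) :
  (forall i, measurable_fun D (h i)) ->
  measurable_fun D (fun t => \sum_(i <- s) h i t).
Proof.
move=> mh; elim: s => [|i s IH].
  by under eq_fun do rewrite big_nil; exact: measurable_cst.
by under eq_fun do rewrite big_cons; exact: measurable_funD.
Qed.

Lemma measurable_dotrv D h k : measurable_fun D h -> measurable_fun D k ->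
  measurable_fun D (fun t => dotrv (h t) (k t)).
Proof.
move=> mh mk; apply: measurable_sumr => i.
by apply: measurable_funM; exact: measurable_coord.
Qed.

Lemma measurable_clip D (G : R) h : 0 <= G ->
  measurable_fun D h -> measurable_fun D (fun t => clip G (h t) : borel_rV R n).
Proof.
move=> G0 mh; apply: measurable_rVZ => //.
apply: (@measurableT_comp _ _ _ _ _ _ (fun a : R => (Num.max 1 (a / G))^-1));
  last exact: measurable_enorm.
(* The scaling factor is a nonincreasing function of the norm. *)
apply: nonincreasing_measurable => // a b ab.
rewrite lef_pV2 ?posrE ?lt_max ?ltr01//.
by rewrite ge_max le_max lexx/= le_max ler_wpM2r ?invr_ge0 ?orbT.
Qed.

End measurable_row_vectors.

Section iterates.
Context {R : realType} {n : nat} {dS : measure_display} {S : measurableType dS}.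
Variables (X : set 'rV[R]_n) (x0 : 'rV[R]_n) (r eta G : R).
Variable g : 'rV[R]_n -> S -> 'rV[R]_n.
Hypotheses (clX : closed X)
  (cvX : convex_set (X : set (convex_lmodType 'rV[R]_n))) (Xx0 : X x0).
Hypotheses (r0 : 0 <= r) (G0 : 0 <= G).

Definition trust_region := X `&` [set y | enorm (y - x0) <= r].

Lemma closed_trust_region : closed trust_region.
Proof.
rewrite /trust_region.
rewrite (_ : [set y | _] = (fun y => enorm (x0 - y)) @^-1` [set a | a <= r]).
  apply: closedI => //; apply: closed_comp; last exact: closed_le.
  by move=> y _; exact: enormB_continuous.
by apply/seteqP; split=> y /=; rewrite enormC.
Qed.

Lemma convex_trust_region :
  convex_set (trust_region : set (convex_lmodType 'rV[R]_n)).
Proof.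
move=> y z t; rewrite !inE => -[Xy yr] [Xz zr].
have t01 : 0 <= t%:num <= 1 by rewrite ge0 le1.
suff : trust_region (t%:num *: (y : 'rV[R]_n) + (1 - t%:num) *: z) by [].
split=> /=; first exact: (convex_setP cvX t01).
have -> : t%:num *: (y : 'rV[R]_n) + (1 - t%:num) *: z - x0 =
    t%:num *: (y - x0) + (1 - t%:num) *: (z - x0).
  by apply/rowP => i; rewrite !mxE; ring.
apply: le_trans (ler_enormD _ _) _; rewrite !enormZ.
have /andP[t0 t1] := t01.
rewrite !ger0_norm ?subr_ge0//.
have -> : r = t%:num * r + (1 - t%:num) * r by ring.
by rewrite lerD// ler_wpM2l ?subr_ge0.
Qed.

Lemma trust_region_center : trust_region x0.
Proof. by split=> //=; rewrite subrr enorm0. Qed.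

Lemma clipped_sgd_trust_region (s : nat -> S) t :
  trust_region (clipped_sgd X r eta G g x0 s t).
Proof.
case: t => [|t]; first exact: trust_region_center.
by have [] := eprojP closed_trust_region
  (ex_intro _ _ trust_region_center) (clipped_sgd X r eta G g x0 s t
  - eta *: clip G (g (clipped_sgd X r eta G g x0 s t) (s t))).
Qed.

Hypothesis mg : @measurable_fun _ _ (borel_rV R n * S)%type (borel_rV R n)
  (X `*` setT) (fun z => g z.1 z.2).

(** Joint measurability of [g] is given on [X] times the sample space, so [h] has to stay in [X], a
    Borel set because it is closed. *)
Lemma measurable_gradient {d} {T : measurableType d}
    (h : T -> borel_rV R n) (s : T -> S) : (forall t, X (h t)) ->
  measurable_fun setT h -> measurable_fun setT s ->
  measurable_fun setT (fun t => g (h t) (s t) : borel_rV R n).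
Proof.
move=> Xh mh ms.
apply: (@measurable_comp _ _ _ T (borel_rV R n * S)%type (borel_rV R n)
  (X `*` setT) (fun z => g z.1 z.2) setT (fun t => (h t, s t))) => //.
- by apply: measurableX => //; exact: closed_borel_measurable.
- by move=> _ [t _ <-]; split=> //=; exact: Xh.
- exact: measurable_fun_pair.
Qed.

(** [T] is arbitrary and only the first [t] samples have to be measurable: this covers both the full
    sigma-algebra and that of the past. *)
Lemma measurable_clipped_sgd {d} {T : measurableType d} (s : nat -> T -> S) t :
  (forall i, (i < t)%N -> measurable_fun setT (s i)) ->
  measurable_fun setT
    (fun w => clipped_sgd X r eta G g x0 (fun i => s i w) t : borel_rV R n).
Proof.
elim: t => [|t IH] ms /=; first exact: measurable_cst.
have {}IH := IH (fun i it => ms i (ltnW it)).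
apply: (@measurableT_comp _ _ _ _ _ _ (eproj trust_region : borel_rV R n -> borel_rV R n)).
  apply: continuous_borel_measurable_rV; apply: eproj_continuous.
  - exact: closed_trust_region.
  - exact: convex_trust_region.
  - by exists x0; exact: trust_region_center.
apply: measurable_rVB => //; apply: measurable_rVZ; first exact: measurable_cst.
apply: measurable_clip => //; apply: measurable_gradient => //; last exact: ms.
by move=> w; have [] := clipped_sgd_trust_region (fun i => s i w) t.
Qed.

End iterates.

(** * The risk function *)

Section jensen.
Context {R : realType} {n : nat}.
Variables (X : set 'rV[R]_n) (F : 'rV[R]_n -> R).
Hypothesis cvX : convex_set (X : set (convex_lmodType 'rV[R]_n)).
Hypothesis cvF : forall x y t, X x -> X y -> 0 <= t <= 1 ->
  F (t *: x + (1 - t) *: y) <= t * F x + (1 - t) * F y.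

(** Membership in [X] is carried through the induction because [F] is convex only on [X]. *)
Lemma jensen_average (x : nat -> 'rV[R]_n) T : (0 < T)%N ->
  (forall t, X (x t)) ->
  X (T%:R^-1 *: \sum_(0 <= t < T) x t) /\
  F (T%:R^-1 *: \sum_(0 <= t < T) x t) <= T%:R^-1 * \sum_(0 <= t < T) F (x t).
Proof.
move=> T0 Xx; case: T T0 => // T _; elim: T => [|T [IHX IHF]].
  by rewrite invr1 scale1r mul1r !big_nat1.
have T1 : (T.+1%:R : R) != 0 by rewrite pnatr_eq0.
have T2 : (T.+2%:R : R) != 0 by rewrite pnatr_eq0.
have t01 : 0 <= (T.+1%:R / T.+2%:R : R) <= 1.
  by rewrite divr_ge0//= ler_pdivrMr// mul1r ler_nat.
have E : 1 - T.+1%:R / T.+2%:R = T.+2%:R^-1 :> R.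
  by rewrite -(natr1 T.+1) in T2 *; field.
rewrite big_nat_recr// [in X in _ <= X]big_nat_recr//=.
(* The new average combines the old average, with weight [T.+1 / T.+2], and the new point, with
   weight [1 / T.+2]. *)
have -> : T.+2%:R^-1 *: (\sum_(0 <= t < T.+1) x t + x T.+1) =
  (T.+1%:R / T.+2%:R) *: (T.+1%:R^-1 *: \sum_(0 <= t < T.+1) x t) +
  (1 - T.+1%:R / T.+2%:R) *: x T.+1.
  by rewrite E scalerDr scalerA mulrAC mulfV// mul1r.
split; first exact: convex_setP.
apply: le_trans (cvF IHX (Xx _) t01) _.
rewrite E mulrDr lerD2r.
have -> : T.+2%:R^-1 * \sum_(0 <= t < T.+1) F (x t) =
  (T.+1%:R / T.+2%:R) * (T.+1%:R^-1 * \sum_(0 <= t < T.+1) F (x t)).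
  by rewrite mulrA (mulrAC T.+1%:R) mulfV// mul1r.
by rewrite ler_wpM2l//; case/andP: t01.
Qed.

End jensen.

Section lipschitz_risk.
Context {R : realType} {n : nat} {dS : measure_display} {S : measurableType dS}.
Variables (X : set 'rV[R]_n) (L r : R) (f : 'rV[R]_n -> S -> R).
Variables (P : probability S R) (g : 'rV[R]_n -> S -> 'rV[R]_n).
Hypotheses (clX : closed X)
  (cvX : convex_set (X : set (convex_lmodType 'rV[R]_n))).
Hypotheses (L0 : 0 < L) (r0 : 0 < r) (inst : SM_Lip X L r f P g).
Implicit Types (x y : 'rV[R]_n).
Local Notation F := (risk f P).

Lemma riskE x : F x = \int[P]_s f x s.
Proof. by rewrite /risk unlock. Qed.

Lemma measurable_loss x : X x -> measurable_fun setT (f x).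
Proof.
by move=> /(SM_Lip_instance inst)/integrableP[+ _] => /measurable_EFinP.
Qed.

Lemma measurable_gradient_at x :
  X x -> measurable_fun setT (g x : S -> borel_rV R n).
Proof.
move=> Xx; apply: (measurable_gradient clX) => //.
exact: selection_measurable (SM_Lip_selection inst).
Qed.

Lemma measurable_gradient_sqr x :
  X x -> measurable_fun setT (fun s => enorm (g x s) ^+ 2).
Proof.
by move=> Xx; apply: measurable_funX; apply: measurable_enorm;
  exact: measurable_gradient_at.
Qed.

Lemma integrable_gradient_sqr x :
  X x -> P.-integrable setT (EFin \o (fun s => enorm (g x s) ^+ 2)).
Proof.
move=> Xx; apply/integrableP; split.
  by apply/measurable_EFinP; exact: measurable_gradient_sqr.
under eq_integral do rewrite /= ger0_norm ?sqr_ge0//.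
have := SM_Lip_moment inst Xx; rewrite unlock => /le_lt_trans; apply.
exact: ltry.
Qed.

Lemma Rintegral_gradient_sqr x :
  X x -> \int[P]_s (enorm (g x s) ^+ 2) <= L ^+ 2.
Proof.
move=> Xx; rewrite -lee_fin fineK; last first.
  by have := integrable_fin_num measurableT (integrable_gradient_sqr Xx).
by have := SM_Lip_moment inst Xx; rewrite unlock.
Qed.

Lemma loss_gradient_le x y s : X x -> X y ->
  f x s - f y s <= dotrv (g x s) (x - y).
Proof.
move=> Xx Xy.
have := selection_subgradient (SM_Lip_selection inst) s Xx Xy.
by rewrite !dotrvBr; lra.
Qed.

(** Linearity of the integral plus the second moment bound. Pointwise bounds of this shape give both
    the Lipschitz property of the risk and the exponential moment of a step. *)
Lemma integral_affine_le x y a b k : X x -> X y -> 0 <= k ->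
  (forall s, 0 <= a + b * (f y s - f x s) + k * enorm (g x s) ^+ 2) ->
  (\int[P]_s (a + b * (f y s - f x s) + k * enorm (g x s) ^+ 2)%:E <=
    (a + b * (F y - F x) + k * L ^+ 2)%:E)%E.
Proof.
move=> Xx Xy k0 W0.
have ifx := SM_Lip_instance inst Xx; have ify := SM_Lip_instance inst Xy.
have ig := integrable_gradient_sqr Xx.
have i1 : P.-integrable setT (EFin \o (fun s => f y s - f x s)).
  by have := integrableB measurableT ify ifx.
have i2 : P.-integrable setT (EFin \o (fun s => b * (f y s - f x s))).
  by have := integrableZl measurableT b i1.
have i3 : P.-integrable setT (EFin \o (fun s => k * enorm (g x s) ^+ 2)).
  by have := integrableZl measurableT k ig.
have i0 : P.-integrable setT (EFin \o (fun _ => a)).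
  exact: finite_measure_integrable_cst.
have i4 : P.-integrable setT (EFin \o (fun s => a + b * (f y s - f x s))).
  by have := integrableD measurableT i0 i2.
have i5 : P.-integrable setT
    (EFin \o (fun s => a + b * (f y s - f x s) + k * enorm (g x s) ^+ 2)).
  by have := integrableD measurableT i4 i3.
have -> : (\int[P]_s (a + b * (f y s - f x s) + k * enorm (g x s) ^+ 2)%:E =
  (\int[P]_s (a + b * (f y s - f x s) + k * enorm (g x s) ^+ 2)%R)%:E)%E.
  by rewrite fineK//; exact: (integrable_fin_num measurableT i5).
rewrite lee_fin RintegralD// RintegralD// RintegralZl// RintegralZl//.
rewrite RintegralB// Rintegral_cst// -!riskE.
have -> : fine (P setT) = 1 by rewrite probability_setT.
by rewrite mulr1 lerD2l ler_wpM2l// Rintegral_gradient_sqr.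
Qed.

(** The subgradient inequality bounds the difference of losses by [u * N] with [u = enorm (g x s)].
    AM-GM makes this quadratic in [u], with weights for which each of the two terms contributes at
    most [L * N / 2] to the integral. *)
Lemma risk_lipschitz x y : X x -> X y -> F x - F y <= L * enorm (x - y).
Proof.
move=> Xx Xy; pose N := enorm (x - y).
have N0 : 0 <= N by exact: enorm_ge0.
have k0 : 0 <= N / (2 * L) by rewrite divr_ge0// mulr_ge0// ltW.
have W0 s : 0 <= L * N / 2 + 1 * (f y s - f x s) + N / (2 * L) * enorm (g x s) ^+ 2.
  have /le_trans /(_ (dotrv_le _ _)) := loss_gradient_le s Xx Xy.
  rewrite -/N; set u := enorm (g x s) => H.
  (* AM-GM: [2 u <= L + u^2 / L] *)
  have : 0 <= N / (2 * L) * (u - L) ^+ 2 by rewrite mulr_ge0// sqr_ge0.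
  have -> : N / (2 * L) * (u - L) ^+ 2 = N / (2 * L) * u ^+ 2 - u * N + L * N / 2.
    by field; rewrite gt_eqF.
  lra.
have := integral_affine_le Xx Xy k0 W0.
have : (0 <= \int[P]_s (L * N / 2 + 1 * (f y s - f x s) + N / (2 * L) * enorm (g x s) ^+ 2)%:E)%E.
  by apply: integral_ge0 => s _; rewrite lee_fin.
move=> /le_trans H /H; rewrite lee_fin.
have -> : N / (2 * L) * L ^+ 2 = L * N / 2 by field; rewrite gt_eqF.
rewrite -/N; lra.
Qed.

Lemma risk_convex x y t : X x -> X y -> 0 <= t <= 1 ->
  F (t *: x + (1 - t) *: y) <= t * F x + (1 - t) * F y.
Proof.
move=> Xx Xy t01; have /andP[t0 t1] := t01.
have Xz := convex_setP cvX t01 Xx Xy.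
have ix := SM_Lip_instance inst Xx; have iy := SM_Lip_instance inst Xy.
have iz := SM_Lip_instance inst Xz.
have jx : P.-integrable setT (EFin \o (fun s => t * f x s)).
  by have := integrableZl measurableT t ix.
have jy : P.-integrable setT (EFin \o (fun s => (1 - t) * f y s)).
  by have := integrableZl measurableT (1 - t) iy.
have jxy : P.-integrable setT (EFin \o (fun s => t * f x s + (1 - t) * f y s)).
  by have := integrableD measurableT jx jy.
rewrite !riskE -RintegralZl// -RintegralZl// -RintegralD//.
apply: le_Rintegral => // s _.
have := SM_Lip_convex inst s => /(_ (Itv01 t0 t1) x y).
by rewrite !inE; apply.
Qed.

(* Composing with the projection extends the risk from [X] to a continuous
   function on the whole space. *)
Lemma risk_eproj_continuous : X !=set0 -> continuous (F \o eproj X).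
Proof.
move=> X0 z; apply/(@cvgrPdist_lt _ _ _ (nbhs z)) => /= e e0.
have eL0 : 0 < e / L by rewrite divr_gt0.
have : enorm (z - y) @[y --> z] --> enorm (z - z).
  exact: enormB_continuous.
rewrite subrr enorm0 => /(@cvgrPdist_lt _ _ _ (nbhs z)) /(_ _ eL0).
apply: filterS => y; rewrite sub0r normrN => /(le_lt_trans (ler_norm _)) H.
have [Xp _] := eprojP clX X0 z; have [Xq _] := eprojP clX X0 y.
have pq : L * enorm (eproj X z - eproj X y) < e.
  rewrite mulrC -ltr_pdivlMr//; apply: le_lt_trans H.
  exact: eproj_nonexpansive.
rewrite ltr_norml ltrNl opprB; apply/andP; split.
  by apply: le_lt_trans (risk_lipschitz Xq Xp) _; rewrite enormC.
exact: le_lt_trans (risk_lipschitz Xp Xq) _.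
Qed.

Lemma measurable_risk {d} {T : measurableType d} (h : T -> borel_rV R n) :
  (forall t, X (h t)) -> measurable_fun setT h ->
  measurable_fun setT (fun t => F (h t)).
Proof.
move=> Xh mh; have X0 : X !=set0.
  by exists (h point); exact: Xh.
rewrite (_ : (fun t => _) = (F \o eproj X : borel_rV R n -> R) \o h).
  apply: measurableT_comp => //; apply: continuous_borel_measurable.
  exact: risk_eproj_continuous.
by apply/funext => t /=; rewrite eproj_id.
Qed.

(* A minimizer of norm at most [r + e], rescaled to norm at most [r]: the
   infimum in [set_enorm] need not be attained for this. *)
Lemma near_minimizer_in_ball e : X 0 -> 0 < e ->
  exists y, [/\ X y, enorm y <= r &
    F y <= inf [set F z | z in X] + L * e].
Proof.
move=> X0 e0.
have /ereal_inf_lt[_ [z [Xz zmin] <-]] :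
    (set_enorm (argmin_risk X f P) < (r + e)%:E)%E.
  by apply: le_lt_trans (SM_Lip_argmin inst) _; rewrite lte_fin ltrDl.
rewrite lte_fin => zr.
have inf_z : F z <= inf [set F z | z in X].
  by apply: lb_le_inf => [|_ [y Xy <-]]; [exists (F 0), 0|exact: zmin].
have re0 : 0 < r + e by rewrite addr_gt0.
pose t := r / (r + e).
have t01 : 0 <= t <= 1.
  by rewrite divr_ge0 ?(ltW r0) ?(ltW re0)//= ler_pdivrMr// mul1r lerDl ltW.
have /andP[t0 t1] := t01.
have Xtz : X (t *: z).
  by have := convex_setP cvX t01 Xz X0; rewrite scaler0 addr0.
exists (t *: z); split=> //.
- rewrite enormZ ger0_norm// -(ler_pM2r re0) mulrAC divfK ?gt_eqF//.
  by rewrite ler_pM2l// ltW.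
- apply: (@le_trans _ _ (F z + L * enorm (t *: z - z))).
    by have := risk_lipschitz Xtz Xz; rewrite lerBlDl.
  apply: lerD => //; rewrite ler_pM2l//.
  have -> : t *: z - z = - ((1 - t) *: z).
    by apply/rowP => i; rewrite !mxE; ring.
  rewrite enormN enormZ ger0_norm ?subr_ge0//.
  (* Rescaling moves [z] by [(1 - t) * enorm z], at most [(1 - t) * (r + e) = e]. *)
  have -> : e = (1 - t) * (r + e) by rewrite /t; field; rewrite gt_eqF.
  by rewrite ler_wpM2l ?subr_ge0// ltW.
Qed.

End lipschitz_risk.

(** * Independence of a sample from the past *)

Section independent_pair.
Local Open Scope ereal_scope.
Context {R : realType} {d d1 d2 : measure_display} {Omega : measurableType d}
  {T1 : measurableType d1} {T2 : measurableType d2}.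
Variables (Q : probability Omega R) (P : probability T2 R).
Variables (X : {RV Q >-> T1}) (Y : {RV Q >-> T2}).
Hypothesis indepXY : forall A B, measurable A -> measurable B ->
  Q (X @^-1` A `&` Y @^-1` B) = Q (X @^-1` A) * P B.

(** The joint law of [(X, Y)] agrees with the product of the law of [X] and [P] on rectangles, hence
    everywhere; Tonelli's theorem then splits the integral. *)
Lemma integral_independent_pair (F : T1 * T2 -> \bar R) :
  measurable_fun setT F -> (forall z, 0 <= F z) ->
  \int[Q]_w F (X w, Y w) = \int[Q]_w \int[P]_y F (X w, y).
Proof.
move=> mF F0.
have mXY : measurable_fun setT (fun w => (X w, Y w)).
  by apply: measurable_fun_pair; exact: measurable_funPT.
pose XY : {RV Q >-> (T1 * T2)%type} := mfun_Sub (mem_set mXY).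
have -> : \int[Q]_w F (X w, Y w) = \int[distribution Q XY]_z F z.
  by rewrite ge0_integral_distribution.
have -> : \int[distribution Q XY]_z F z = \int[distribution Q X \x P]_z F z.
  apply: eq_measure_integral => A mA _; apply/esym.
  exact: product_measure_unique.
rewrite fubini_tonelli1// ge0_integral_distribution//.
- exact: measurable_fun_fubini_tonelli_F.
- by move=> x; apply: integral_ge0.
Qed.

End independent_pair.

(** * The sigma-algebras generated by past samples *)

Section past.
Context {R : realType} {dO dS : measure_display}.
Context {Omega : measurableType dO} {S : measurableType dS}.
Variables (Q : probability Omega R) (P : probability S R).
Variable xi : nat -> {RV Q >-> S}.

(** A family closed under intersection that generates the sigma-algebra of the samples of index less
    than [t], in the form required by Dynkin's theorem. *)
Definition past_cylinder t : set (set Omega) :=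
  [set E | exists2 A : nat -> set S, (forall i, measurable (A i)) &
    E = \bigcap_(i in `I_t) xi i @^-1` A i].

(** [Omega] itself with a coarser sigma-algebra: measurability from [past t] expresses dependence on
    the first [t] samples only. *)
Definition past t := g_sigma_algebraType (past_cylinder t).

Lemma past_cylinder_setI t : setI_closed (past_cylinder t).
Proof.
move=> _ _ [A mA ->] [B mB ->]; exists (fun i => A i `&` B i).
  by move=> i; exact: measurableI.
by rewrite -bigcapI.
Qed.

Lemma measurable_past_sample t i : (i < t)%N ->
  measurable_fun setT (xi i : past t -> S).
Proof.
move=> it _ B mB; rewrite setTI; apply: sub_sigma_algebra.
exists (fun j => if j == i then B else setT).
  by move=> j; case: ifP.
apply/seteqP; split=> [w Bw j _ /=|w /(_ i it)/=]; last by rewrite eqxx.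
by case: eqP => // ->.
Qed.

Lemma measurable_past_of d (T : measurableType d) t (h : T -> Omega) :
  (forall i, (i < t)%N -> measurable_fun setT (xi i \o h)) ->
  measurable_fun setT (h : T -> past t).
Proof.
move=> mh; apply: (@measurability _ _ _ (past t) _ _ (past_cylinder t) (erefl _)).
move=> _ [_ [A mA ->] <-]; rewrite setTI preimage_bigcap.
apply: bigcap_measurableType => i it.
by rewrite -[X in measurable X]setTI; apply: (mh i it).
Qed.

Lemma measurable_to_past t : measurable_fun setT (id : Omega -> past t).
Proof. by apply: measurable_past_of => i _; exact: measurable_funPT. Qed.

Lemma measurable_past_le t t' : (t <= t')%N ->
  measurable_fun setT (id : past t' -> past t).
Proof.
move=> tt'; apply: measurable_past_of => i it.
by apply: measurable_past_sample; exact: leq_trans it tt'.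
Qed.

Hypothesis iidxi : iid P xi.

Lemma iid_measure i A : measurable A -> Q (xi i @^-1` A) = P A.
Proof. by move=> mA; have [_ /(_ i A mA)] := iidxi. Qed.

Lemma iid_cylinder t (A : nat -> set S) : (forall i, measurable (A i)) ->
  Q (\bigcap_(i in `I_t) xi i @^-1` A i) = (\prod_(0 <= i < t) P (A i))%E.
Proof.
move=> mA; have [/(_ [fset i | i in iota 0 t]%fset A (fun i _ => mA i)) + _] := iidxi.
have -> : \bigcap_(i in [set` [fset i | i in iota 0 t]%fset]) xi i @^-1` A i =
    \bigcap_(i in `I_t) xi i @^-1` A i.
  by congr bigcap; apply/seteqP; split=> i /=; rewrite !inE mem_iota.
move=> ->.
rewrite (perm_big (iota 0 t)) /=; last first.
  apply: uniq_perm; [exact: fset_uniq|exact: iota_uniq|].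
  by move=> i; rewrite !inE.
rewrite /index_iota subn0; apply: eq_bigr => i _.
exact: iid_measure.
Qed.

(** Intersecting a cylinder with an event of sample [t] gives a cylinder of length [t.+1], whose
    probability is a product with one more factor. *)
Lemma iid_past_cylinder t E B : past_cylinder t E -> measurable B ->
  Q (E `&` xi t @^-1` B) = (Q E * P B)%E.
Proof.
move=> [A mA ->] mB; rewrite iid_cylinder//.
pose A' i := if i == t then B else A i.
have -> : \bigcap_(i in `I_t) xi i @^-1` A i `&` xi t @^-1` B =
    \bigcap_(i in `I_t.+1) xi i @^-1` A' i.
  apply/seteqP; split=> [w [Aw Bw] i /=|w H].
    rewrite ltnS leq_eqVlt => /orP[/eqP->|it]; first by rewrite /A' eqxx.
    by rewrite /A' ltn_eqF//; exact: Aw.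
  split=> [i /= it|]; last by have := H t (ltnSn t); rewrite /A' /= eqxx.
  by have := H i (ltnW it); rewrite /A' /= ltn_eqF.
rewrite iid_cylinder => [|i]; last by rewrite /A'; case: ifP.
rewrite big_nat_recr//= /A' eqxx; congr (_ * _)%E.
by apply: eq_big_nat => i /andP[_ it]; rewrite ltn_eqF.
Qed.

(** Dynkin's theorem: the identity holds on cylinders and passes to complements and countable
    disjoint unions. *)
Lemma iid_past t (E : set (past t)) B : measurable E -> measurable B ->
  Q (E `&` xi t @^-1` B) = (Q E * P B)%E.
Proof.
move=> mE mB.
have mO (F : set (past t)) : measurable F -> dO.-measurable (F : set Omega).
  move=> mF; have := @measurable_to_past t measurableT F mF.
  by rewrite setTI.
have mxB : dO.-measurable (xi t @^-1` B).
  by rewrite -[X in measurable X]setTI; exact: measurable_funPT.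
have finP : P B \is a fin_num by rewrite fin_num_measure.
apply: (@dynkin_induction _ (past t) (past_cylinder t)
  (fun E => Q (E `&` xi t @^-1` B) = (Q E * P B)%E)) => //.
- exact: past_cylinder_setI.
- by rewrite setTI probability_setT mul1e iid_measure.
- by move=> F GF; exact: iid_past_cylinder.
- move=> F mF IH; have mF' := mO _ mF.
  have -> : ~` F `&` xi t @^-1` B = xi t @^-1` B `\` F by rewrite setIC.
  have -> : Q (xi t @^-1` B `\` F) = (Q (xi t @^-1` B) - Q (F `&` xi t @^-1` B))%E.
    by rewrite setIC; apply: measureD => //; rewrite ltey_eq fin_num_measure.
  rewrite IH.
  rewrite iid_measure// probability_setC// muleBl//.
  by rewrite mul1e.
- move=> F mF tF IH; have mF' i := mO _ (mF i).
  rewrite setI_bigcupl.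
  rewrite measure_bigcup//=; last 2 first.
  + by move=> i _; exact: measurableI.
  + apply/trivIsetP => i j _ _ ij; rewrite setIACA.
    by move/trivIsetP : tF => /(_ i j I I ij) ->; rewrite set0I.
  rewrite measure_bigcup//= muleC.
  rewrite -(fineK finP) -nneseriesZl//.
  by apply: eq_eseriesr => i _; rewrite IH fineK// muleC.
Qed.

(** Replaces conditional expectation given the past: the identity from [Omega] to [past t] is a
    random variable independent of [xi t]. *)
Lemma integral_past_sample t (F : past t * S -> \bar R) :
  measurable_fun setT F -> (forall z, (0 <= F z)%E) ->
  (\int[Q]_w F (w, xi t w) = \int[Q]_w \int[P]_s F (w, s))%E.
Proof.
move=> mF F0.
pose I : {RV Q >-> past t} := mfun_Sub (mem_set (@measurable_to_past t)).
apply: (integral_independent_pair (P := P) (X := I) (Y := xi t)) => //.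
by move=> A B mA mB; exact: iid_past.
Qed.

(** * Exponential supermartingale bound for adapted increments *)

Variables (u : nat -> Omega -> S -> R) (c : R).
Hypothesis mu : forall t,
  measurable_fun setT (fun z : past t * S => u t z.1 z.2).
Hypothesis u_le : forall t w, (\int[P]_s (expR (u t w s))%:E <= (expR c)%:E)%E.
Local Notation U t w := (\sum_(0 <= i < t) u i w (xi i w)).

Lemma measurable_past_sum t :
  measurable_fun setT (fun w : past t => U t w).
Proof.
under eq_fun do rewrite big_mkord.
apply: measurable_sumr => i.
apply: (@measurableT_comp _ _ _ _ _ _ (fun z : past i * S => u i z.1 z.2) _
  (fun w : past t => (w, xi i w))); first exact: mu.
apply: measurable_fun_pair.
  by apply: measurable_past_le; exact: ltnW.
exact: measurable_past_sample.
Qed.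

Lemma measurable_sample_sum t :
  measurable_fun setT (fun w : Omega => U t w).
Proof.
exact: (measurableT_comp (measurable_past_sum (t := t)) (measurable_to_past (t := t))).
Qed.

(** Integrate over the last sample first: the exponential of the earlier increments depends on the
    past only and factors out, and the inner integral is at most [expR c]. *)
Lemma integral_expR_sum_le t :
  (\int[Q]_w (expR (U t w))%:E <= (expR (t%:R * c))%:E)%E.
Proof.
elim: t => [|t IH].
  under eq_integral do rewrite big_nil expR0.
  by rewrite integral_cst//= probability_setT mule1 mul0r expR0.
under eq_integral do rewrite big_nat_recr//= expRD EFinM.
pose F (z : past t * S) := ((expR (U t z.1))%:E * (expR (u t z.1 z.2))%:E)%E.
have mF : measurable_fun setT F.
  apply: emeasurable_funM; apply/measurable_EFinP.
    apply: measurableT_comp; first exact: measurable_expR.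
    apply: (@measurableT_comp _ _ _ _ _ _ (fun w : past t => U t w)).
      exact: measurable_past_sum.
    exact: measurable_fst.
  by apply: measurableT_comp; [exact: measurable_expR|exact: mu].
have F0 z : (0 <= F z)%E by rewrite mule_ge0// lee_fin expR_ge0.
rewrite (integral_past_sample mF F0).
have mU : measurable_fun setT (fun w : Omega => (expR (U t w))%:E).
  apply/measurable_EFinP; apply: measurableT_comp; first exact: measurable_expR.
  exact: measurable_sample_sum.
apply: (@le_trans _ _ (\int[Q]_w ((expR c)%:E * (expR (U t w))%:E))%E).
  apply: ge0_le_integral => //.
  - by move=> w _; apply: integral_ge0.
  - have := measurableT_comp (measurable_fun_fubini_tonelli_F (m2 := P) F mF F0)
      (measurable_to_past (t := t)).
    exact.
  - by apply: measurable_funeM.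
  move=> w _; rewrite /F/= ge0_integralZl//=.
  - by rewrite muleC lee_wpmul2r ?lee_fin ?expR_ge0.
  - apply/measurable_EFinP; apply: measurableT_comp; first exact: measurable_expR.
    exact: (measurableT_comp (mu (t := t)) (pair1_measurable _)).
rewrite ge0_integralZl//=.
rewrite -natr1 mulrDl mul1r expRD EFinM muleC.
by rewrite lee_wpmul2r// lee_fin expR_ge0.
Qed.

(** Chernoff bound with parameter 1; any scaling is already part of [u]. *)
Lemma probability_sum_ge t b :
  (Q [set w | (b <= U t w)%R] <= (expR (t%:R * c - b))%:E)%E.
Proof.
pose V : {RV Q >-> R} := mfun_Sub (mem_set (measurable_sample_sum t)).
apply: le_trans (chernoff V b ltr01) _.
rewrite mul1r expRD EFinM lee_wpmul2r ?lee_fin ?expR_ge0//.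
rewrite /mmt_gen_fun unlock; under eq_integral do rewrite /= mulr1.
exact: integral_expR_sum_le.
Qed.

End past.

(** * Clipping and regret *)

Section clipping.
Context {R : realType} {n : nat}.
Variables (G : R) (v : 'rV[R]_n).
Hypothesis G0 : 0 < G.

Lemma clip_id : enorm v <= G -> clip G v = v.
Proof.
move=> vG; rewrite /clip max_l ?invr1 ?scale1r//.
by rewrite ler_pdivrMr// mul1r.
Qed.

Lemma clip_ge : G <= enorm v -> clip G v = (G / enorm v) *: v.
Proof.
by move=> vG; rewrite /clip max_r ?invf_div// ler_pdivlMr// mul1r.
Qed.

Lemma enorm_clip_ge : G <= enorm v -> enorm (clip G v) = G.
Proof.
move=> vG; have v0 := lt_le_trans G0 vG.
by rewrite clip_ge// enormZ ger0_norm ?divr_ge0 ?ltW// divfK ?gt_eqF.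
Qed.

Lemma enorm_clip_le_param : enorm (clip G v) <= G.
Proof.
have [vG|/ltW vG] := leP (enorm v) G; first by rewrite clip_id.
by rewrite enorm_clip_ge.
Qed.

Lemma enorm_clip_le : enorm (clip G v) <= enorm v.
Proof.
have [vG|/ltW vG] := leP (enorm v) G; first by rewrite clip_id.
by rewrite enorm_clip_ge.
Qed.

(** When clipping acts, a vector of norm [enorm v - G] is removed, and
    [(enorm v - G) * G <= enorm v ^+ 2]. *)
Lemma clip_bias_le : enorm (v - clip G v) <= enorm v ^+ 2 / G.
Proof.
have [vG|/ltW vG] := leP (enorm v) G.
  by rewrite clip_id// subrr enorm0 divr_ge0 ?sqr_ge0// ltW.
have v0 := lt_le_trans G0 vG.
rewrite clip_ge// -{1}(scale1r v) -scalerBl enormZ ger0_norm; last first.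
  by rewrite subr_ge0 ler_pdivrMr// mul1r.
rewrite mulrBl mul1r divfK ?gt_eqF// ler_pdivlMr//.
nra.
Qed.

End clipping.

Lemma expR_le_quadratic {R : realType} (z : R) :
  z <= 1 -> expR z <= 1 + z + 2 * z ^+ 2.
Proof.
(* [exp z = exp (z/2) ^ 2 <= (1 - z/2)^-2] *)
move=> z1; pose h := z / 2.
have h1 : 0 < 1 - h by rewrite /h; lra.
have eh : expR h * (1 - h) <= 1.
  have := expR_ge1Dx (- h); rewrite expRN => H.
  by rewrite mulrC -ler_pdivlMr ?expR_gt0// mul1r.
have -> : z = h + h by rewrite /h; lra.
have {}z1 : h <= 2^-1 by rewrite /h; lra.
rewrite expRD.
have e0 : 0 <= expR h by exact: expR_ge0.
have E : (expR h * (1 - h)) ^+ 2 <= 1.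
  by rewrite expr_le1// mulr_ge0// ltW.
have h2 : 0 < (1 - h) ^+ 2 by rewrite exprn_gt0.
rewrite -(ler_pM2r h2).
apply: (@le_trans _ _ 1).
  by move: E; rewrite exprMn expr2.
(* This is exactly [(1 + 2 * h + 8 * h ^+ 2) * (1 - h) ^+ 2 - 1], nonnegative since [h <= 1 / 2]. *)
have : 0 <= h ^+ 2 * ((1 - 2 * h) * (5 - 4 * h)).
  by rewrite mulr_ge0 ?sqr_ge0// mulr_ge0//; lra.
nra.
Qed.

Section regret.
Context {R : realType} {n : nat} {dS : measure_display} {S : measurableType dS}.
Variables (X : set 'rV[R]_n) (x0 y : 'rV[R]_n) (r eta G : R).
Variable g : 'rV[R]_n -> S -> 'rV[R]_n.
Hypotheses (clX : closed X)
  (cvX : convex_set (X : set (convex_lmodType 'rV[R]_n))) (Xx0 : X x0).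
Hypotheses (r0 : 0 <= r) (eta0 : 0 < eta).
Hypothesis Ky : trust_region X x0 r y.

(** Scaled by [2 * eta], this is the change of the squared distance to [y] in one step before
    projecting. *)
Definition step_gain (x : 'rV[R]_n) (s : S) : R :=
  - dotrv (clip G (g x s)) (x - y) + eta / 2 * enorm (clip G (g x s)) ^+ 2.

Lemma step_gain_sum_ge (s : nat -> S) t :
  - (enorm (x0 - y) ^+ 2 / (2 * eta)) <=
  \sum_(0 <= i < t) step_gain (clipped_sgd X r eta G g x0 s i) (s i).
Proof.
(* Telescoped form of the claim, which follows because the final squared distance is nonnegative. *)
suff H : enorm (clipped_sgd X r eta G g x0 s t - y) ^+ 2 <= enorm (x0 - y) ^+ 2 +
    2 * eta * \sum_(0 <= i < t) step_gain (clipped_sgd X r eta G g x0 s i) (s i).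
  have eta2 : 0 < 2 * eta by rewrite mulr_gt0.
  rewrite -mulNr ler_pdivrMr//.
  by have := le_trans (sqr_ge0 _) H; lra.
elim: t => [|t IH]; first by rewrite big_nil mulr0 addr0.
rewrite big_nat_recr//=.
set x := clipped_sgd X r eta G g x0 s t in IH *.
rewrite {2}/step_gain; move: (clip G (g x (s t))) => c.
have nK : trust_region X x0 r !=set0 by exists y.
(* As [y] lies in the trust region, projecting does not increase the distance to it. *)
have := enorm_eproj_sub_le (closed_trust_region (x0 := x0) (r := r) clX)
  (convex_trust_region (x0 := x0) (r := r) cvX) nK (x - eta *: c) Ky.
rewrite -ler_sqr ?nnegrE ?enorm_ge0// => /le_trans; apply.
have -> : x - eta *: c - y = (x - y) - eta *: c by rewrite addrAC.
rewrite [leLHS]enorm_sqr !(dotrvBl (x - y), dotrvBr _ (x - y)) !dotrvZl !dotrvZr.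
rewrite -(enorm_sqr (x - y)) -(enorm_sqr c) (dotrvC (x - y) c).
rewrite mulrDr addrA.
have -> : 2 * eta * (- dotrv c (x - y) + eta / 2 * enorm c ^+ 2) =
  - (2 * eta * dotrv c (x - y)) + eta ^+ 2 * enorm c ^+ 2 by field.
move: IH; lra.
Qed.

End regret.

(** * Exponential moment of one step *)

Section one_step.
Context {R : realType} {n : nat} {dS : measure_display} {S : measurableType dS}.
Variables (X : set 'rV[R]_n) (L r : R) (f : 'rV[R]_n -> S -> R).
Variables (P : probability S R) (g : 'rV[R]_n -> S -> 'rV[R]_n).
Variables (eta G lam : R) (x y : 'rV[R]_n).
Hypotheses (clX : closed X) (inst : SM_Lip X L r f P g).
Hypotheses (r0 : 0 < r) (eta0 : 0 < eta) (G0 : 0 < G) (lam0 : 0 < lam).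
Hypotheses (etaG : eta * G <= 2 * r) (lamG : 3 * r * G * lam <= 1).
Hypotheses (Xx : X x) (Xy : X y) (xy : enorm (x - y) <= 2 * r).
Local Notation F := (risk f P).
Local Notation V := (step_gain y eta G g x).

(** The terms come, in order, from the clipping bias, the quadratic cost of the step, and the second
    order term [2 * (lam * 3 * r) ^+ 2] of the exponential. *)
Let kappa := 2 * r * lam / G + lam * eta / 2 + 18 * (lam * r) ^+ 2.

(** The linear term is at most [2 * r * enorm c] for the clipped subgradient [c]; the quadratic one
    adds [r * enorm c] because [eta * enorm c <= eta * G <= 2 * r]. *)
Lemma abs_step_gain_le s : `|V s| <= 3 * r * enorm (clip G (g x s)).
Proof.
have := enorm_clip_le_param (g x s) G0; rewrite /step_gain.
move: (clip G (g x s)) => c cG; have c0 : 0 <= enorm c by exact: enorm_ge0.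
apply: le_trans (ler_normD _ _) _; rewrite normrN.
rewrite [X in _ + X]ger0_norm ?mulr_ge0 ?sqr_ge0 ?invr_ge0 ?(ltW eta0)//.
have H1 : `|dotrv c (x - y)| <= enorm c * (2 * r).
  by apply: le_trans (abs_dotrv_le _ _) _; rewrite ler_wpM2l.
have H2 : eta * enorm c <= 2 * r.
  by apply: le_trans etaG; rewrite ler_pM2l.
have : eta * enorm c * enorm c <= 2 * r * enorm c by rewrite ler_wpM2r.
move: H1; lra.
Qed.

(** Replace the clipped subgradient by the true one at the price of the bias, then apply the
    subgradient inequality. *)
Lemma step_gain_le s :
  V s <= f y s - f x s + (2 * r / G + eta / 2) * enorm (g x s) ^+ 2.
Proof.
rewrite /step_gain; set v := g x s; set c := clip G v.
have H1 := loss_gradient_le inst s Xx Xy; rewrite -/v in H1.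
have H2 : dotrv (v - c) (x - y) <= enorm v ^+ 2 / G * (2 * r).
  apply: le_trans (dotrv_le _ _) _.
  by apply: ler_pM; rewrite ?enorm_ge0//; exact: clip_bias_le.
have H3 : eta / 2 * enorm c ^+ 2 <= eta / 2 * enorm v ^+ 2.
  by rewrite ler_pM2l ?divr_gt0// lerXn2r ?nnegrE ?enorm_ge0// enorm_clip_le.
move: H2; rewrite dotrvBl => H2.
have -> : (2 * r / G + eta / 2) * enorm v ^+ 2 =
  enorm v ^+ 2 / G * (2 * r) + eta / 2 * enorm v ^+ 2 by ring.
lra.
Qed.

(** In the quadratic bound on the exponential, [step_gain_le] controls the linear term and
    [abs_step_gain_le] the square. *)
Lemma expR_step_gain_le s : expR (lam * V s) <=
  1 + lam * (f y s - f x s) + kappa * enorm (g x s) ^+ 2.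
Proof.
have aV := abs_step_gain_le s.
have cG : enorm (clip G (g x s)) <= G by exact: enorm_clip_le_param.
have cg : enorm (clip G (g x s)) <= enorm (g x s) by exact: enorm_clip_le.
have V1 : lam * V s <= 1.
  apply: le_trans lamG; rewrite mulrC ler_pM2r//.
  apply: le_trans (ler_norm _) _; apply: le_trans aV _.
  by rewrite ler_pM2l// mulr_gt0.
apply: le_trans (expR_le_quadratic V1) _.
have V2 : V s ^+ 2 <= (3 * r * enorm (g x s)) ^+ 2.
  rewrite -(real_normK (num_real (V s))) lerXn2r ?nnegrE ?mulr_ge0 ?enorm_ge0 ?(ltW r0)//.
  by apply: le_trans aV _; rewrite ler_pM2l// mulr_gt0.
have V3 : lam * V s <= lam * (f y s - f x s +
    (2 * r / G + eta / 2) * enorm (g x s) ^+ 2).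
  by rewrite ler_pM2l// step_gain_le.
have V4 : 2 * lam ^+ 2 * V s ^+ 2 <= 2 * lam ^+ 2 * (3 * r * enorm (g x s)) ^+ 2.
  by rewrite ler_wpM2l// mulr_ge0// sqr_ge0.
have -> : kappa * enorm (g x s) ^+ 2 =
  lam * ((2 * r / G + eta / 2) * enorm (g x s) ^+ 2) +
  2 * lam ^+ 2 * (3 * r * enorm (g x s)) ^+ 2 by rewrite /kappa; ring.
rewrite exprMn mulrA; move: V3; rewrite mulrDr; lra.
Qed.

(** After integration [1 + z <= expR z] restores an exponential, and the factor
    [expR (lam * (F x - F y))] cancels its linear part. *)
Lemma one_step_exponential_moment :
  (\int[P]_s (expR (lam * (F x - F y + V s)))%:E <= (expR (kappa * L ^+ 2))%:E)%E.
Proof.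
have k0 : 0 <= kappa.
  by rewrite !addr_ge0 ?mulr_ge0 ?invr_ge0 ?sqr_ge0 ?ltW.
have mV : measurable_fun setT (fun s => V s).
  have mc : measurable_fun setT (fun s => clip G (g x s) : borel_rV R n).
    apply: measurable_clip; first exact: ltW.
    exact: measurable_gradient_at clX inst _ Xx.
  apply: measurable_funD.
    by apply: measurable_funN; apply: measurable_dotrv.
  apply: measurable_funM => //; apply: measurable_funX.
  exact: measurable_enorm.
have mexp : measurable_fun setT (fun s => expR (lam * V s)).
  apply: measurableT_comp; first exact: measurable_expR.
  by apply: measurable_funM.
have W0 s : 0 <= 1 + lam * (f y s - f x s) + kappa * enorm (g x s) ^+ 2.
  exact: le_trans (expR_ge0 _) (expR_step_gain_le s).
have H : (\int[P]_s (expR (lam * V s))%:E <=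
    (1 + lam * (F y - F x) + kappa * L ^+ 2)%:E)%E.
  apply: le_trans (integral_affine_le clX inst Xx Xy k0 W0).
  apply: ge0_le_integral => //.
  - exact/measurable_EFinP.
  - apply/measurable_EFinP; apply: measurable_funD.
      apply: measurable_funD => //; apply: measurable_funM => //.
      by apply: measurable_funB; exact: measurable_loss inst _ _.
    by apply: measurable_funM => //; exact: measurable_gradient_sqr clX inst _ _.
  - by move=> s _; rewrite lee_fin expR_step_gain_le.
under eq_integral do rewrite mulrDr expRD EFinM.
rewrite ge0_integralZl//=; last exact/measurable_EFinP.
apply: le_trans (lee_wpmul2l _ H) _; first by rewrite lee_fin expR_ge0.
rewrite -EFinM lee_fin.
apply: (@le_trans _ _ (expR (lam * (F x - F y)) *
  expR (lam * (F y - F x) + kappa * L ^+ 2))).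
  rewrite ler_pM2l ?expR_gt0// -addrA; exact: expR_ge1Dx.
by rewrite -expRD ler_expR addrA -mulrDr subrKA subrr mulr0 add0r.
Qed.

End one_step.

(* Here [tau] is [sqrt T] and [l] is [sqrt (ln (1 / delta))]. *)
Lemma clipped_sgd_parameters {R : realType} (L r tau l : R) :
  0 < L -> 0 < r -> 0 < tau -> 2^-1 <= l ->
  let eta := r / (L * tau) in
  let G := L * tau / l in
  let lam := l / (3 * L * r * tau) in
  [/\ eta * G <= 2 * r, 3 * r * G * lam <= 1 &
    (2 * r * lam / G + lam * eta / 2 + 18 * (lam * r) ^+ 2) * L ^+ 2 <=
    3 * (l / tau) ^+ 2].
Proof.
move=> L0 r0 t0 l2 eta G lam.
have l0 : 0 < l by lra.
have nz : [/\ L != 0, r != 0, tau != 0 & l != 0] by rewrite !gt_eqF.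
have [Ln rn tn ln] := nz.
split.
- have -> : eta * G = r / l by rewrite /eta /G; field; rewrite Ln tn ln.
  rewrite ler_pdivrMr//; nra.
- have -> : 3 * r * G * lam = 1 by rewrite /G /lam; field; rewrite Ln tn ln rn.
  by [].
(* Bias and second order term give [2 / 3 * l ^+ 2] and [2 * l ^+ 2]; the remaining [l / 6] is at
   most [l ^+ 2 / 3] since [l >= 1 / 2]. *)
- have -> : (2 * r * lam / G + lam * eta / 2 + 18 * (lam * r) ^+ 2) * L ^+ 2 =
    (8 / 3 * l ^+ 2 + l / 6) / tau ^+ 2.
    by rewrite /G /lam /eta; field; rewrite Ln tn ln rn.
  rewrite expr_div_n [leRHS]mulrA ler_pM2r ?invr_gt0 ?exprn_gt0//.
  nra.
Qed.

(** * Tail bound for the cumulative regret *)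

Section high_probability.
Context {R : realType} {n : nat} {dS dO : measure_display}.
Context {S : measurableType dS} {Omega : measurableType dO}.
Variables (P : probability S R) (Q : probability Omega R).
Variables (X : set 'rV[R]_n) (f : 'rV[R]_n -> S -> R).
Variables (g : 'rV[R]_n -> S -> 'rV[R]_n) (L r : R).
Variables (xi : nat -> {RV Q >-> S}) (y : 'rV[R]_n) (eta G lam : R).
Hypotheses (clX : closed X)
  (cvX : convex_set (X : set (convex_lmodType 'rV[R]_n))) (X0 : X 0).
Hypotheses (inst : SM_Lip X L r f P g) (iidxi : iid P xi).
Hypotheses (L0 : 0 < L) (r0 : 0 < r) (eta0 : 0 < eta) (G0 : 0 < G) (lam0 : 0 < lam).
Hypotheses (etaG : eta * G <= 2 * r) (lamG : 3 * r * G * lam <= 1).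
Hypotheses (Xy : X y) (yr : enorm y <= r).
Local Notation F := (risk f P).
Local Notation x t w := (clipped_sgd X r eta G g 0 (fun i => xi i w) t).
Local Notation kappa :=
  (2 * r * lam / G + lam * eta / 2 + 18 * (lam * r) ^+ 2).

Let r0' : 0 <= r := ltW r0.

Let mg := selection_measurable (SM_Lip_selection inst).

Lemma iterate_in_domain t w : X (x t w).
Proof.
by have [] := clipped_sgd_trust_region eta G g clX X0 r0' (fun i => xi i w) t.
Qed.

Lemma measurable_iterate t :
  measurable_fun setT (fun w : past xi t => x t w : borel_rV R n).
Proof.
apply: (measurable_clipped_sgd eta clX cvX X0 r0' (ltW G0) mg
  (s := fun i (w : past xi t) => xi i w)) => i.
exact: measurable_past_sample.
Qed.

Let u t (w : Omega) s : R :=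
  lam * (F (x t w) - F y + step_gain y eta G g (x t w) s).

Let mu t : measurable_fun setT (fun z : past xi t * S => u t z.1 z.2).
Proof.
pose h (z : past xi t * S) : borel_rV R n := x t z.1.
have mh : measurable_fun setT h.
  by apply: (measurableT_comp (measurable_iterate (t := t))); exact: measurable_fst.
have Xh z : X (h z) by exact: iterate_in_domain.
have mc : measurable_fun setT
    (fun z : past xi t * S => clip G (g (h z) z.2) : borel_rV R n).
  apply: measurable_clip; first exact: ltW.
  apply: (measurable_gradient clX mg Xh mh); exact: measurable_snd.
apply: measurable_funM => //; apply: measurable_funD.
  apply: measurable_funB => //.
  exact: (measurable_risk clX cvX L0 inst Xh mh).
apply: measurable_funD.
  apply: measurable_funN; apply: measurable_dotrv => //.
  by apply: measurable_rVB => //; exact: measurable_cst.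
apply: measurable_funM => //; apply: measurable_funX; exact: measurable_enorm.
Qed.

(** The gains sum to at least [- r ^+ 2 / (2 * eta)], so on [A] the sum of the increments [u] is at
    least [b], and the Chernoff bound applies. *)
Lemma probability_regret_ge T b (A : set Omega) : measurable A ->
  A `<=` [set w | b + lam * (r ^+ 2 / (2 * eta)) <=
    lam * \sum_(0 <= t < T) (F (x t w) - F y)] ->
  (Q A <= (expR (T%:R * (kappa * L ^+ 2) - b))%:E)%E.
Proof.
move=> mA subA.
have u_le t w : (\int[P]_s (expR (u t w s))%:E <= (expR (kappa * L ^+ 2))%:E)%E.
  apply: (one_step_exponential_moment clX inst) => //.
    exact: iterate_in_domain.
  have [_ xr] := clipped_sgd_trust_region eta G g clX X0 r0' (fun i => xi i w) t.
  rewrite /= subr0 in xr; apply: le_trans (ler_enormB _ _) _.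
  by rewrite mulrDl mul1r lerD.
apply: le_trans (probability_sum_ge iidxi mu u_le T b).
apply: le_measure; rewrite ?inE//.
  have mU : measurable_fun setT
      (fun w : Omega => \sum_(0 <= t < T) u t w (xi t w)).
    exact: measurable_sample_sum.
  rewrite -[X in measurable X]setTI -preimage_true.
  exact: (measurable_fun_ler _ mU).
move=> w /subA /= H; apply: (@le_trans _ _ (lam * \sum_(0 <= t < T) (F (x t w) - F y) -
  lam * (r ^+ 2 / (2 * eta)))); first by rewrite lerBrDr.
rewrite -mulr_sumr [X in _ <= _ * X]big_split/= -mulrBr ler_pM2l// lerD2l.
have Ky : trust_region X 0 r y by split=> //=; rewrite subr0.
apply: le_trans (step_gain_sum_ge G g clX cvX eta0 Ky (fun i => xi i w) T).
rewrite lerN2 ler_pM2r ?invr_gt0 ?mulr_gt0// sub0r enormN.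
by rewrite lerXn2r ?nnegrE ?enorm_ge0.
Qed.

End high_probability.

Theorem mainTheorem5 (R : realType) :
  exists C : R,
  forall (n : nat) (dS dO : measure_display)
    (S : measurableType dS) (Omega : measurableType dO)
    (P : probability S R) (Q : probability Omega R)
    (X : set 'rV[R]_n)
    (f : 'rV[R]_n -> S -> R) (g : 'rV[R]_n -> S -> 'rV[R]_n)
    (delta L r : R) (T : nat) (xi : nat -> {RV Q >-> S}),
  closed X ->
  convex_set (X : set (convex_lmodType 'rV[R]_n)) ->
  X 0 ->
  0 < delta < 2^-1 ->
  0 < L ->
  0 < r ->
  (0 < T)%N ->
  SM_Lip X L r f P g ->
  iid P xi ->
  let eta := r / (L * Num.sqrt T%:R) in
  let G := L * Num.sqrt T%:R / Num.sqrt (ln (1 / delta)) in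
  let x t w := clipped_sgd X r eta G g 0 (fun i => xi i w) t in
  let xbar w := T%:R^-1 *: \sum_(0 <= t < T) x t w in
  ((1 - delta)%:E <=
   Q [set w | (risk f P (xbar w) - inf [set risk f P y | y in X]
              <= C * (L * r / Num.sqrt T%:R) * Num.sqrt (ln (1 / delta)))%R])%E.
Proof.
(* With [l ^+ 2 = ln (1 / delta)], scaling by [lam * T] turns 15 into [5 * l ^+ 2]: three parts for
   the exponential moment, one for the probability [delta], and one to absorb terms linear in
   [l]. *)
exists 15 => n dS dO S Omega P Q X f g delta L r T xi.
move=> clX cvX X0 /andP[d0 d2] L0 r0 T0 inst iidxi.
pose eta := r / (L * Num.sqrt T%:R).
pose G := L * Num.sqrt T%:R / Num.sqrt (ln (1 / delta)).
pose x t w := clipped_sgd X r eta G g 0 (fun i => xi i w) t.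
pose xbar w := T%:R^-1 *: \sum_(0 <= t < T) x t w.
suff : ((1 - delta)%:E <= Q [set w | (risk f P (xbar w) -
    inf [set risk f P y | y in X] <= 15 * (L * r / Num.sqrt T%:R) *
    Num.sqrt (ln (1 / delta)))%R])%E by [].
pose l : R := Num.sqrt (ln (1 / delta)); pose tau : R := Num.sqrt T%:R.
pose lam := l / (3 * L * r * tau).
have tau2 : tau ^+ 2 = T%:R by rewrite sqr_sqrtr.
have tau0 : 0 < tau by rewrite sqrtr_gt0 ltr0n.
(* From [1 - ln (1 / delta) <= expR (- ln (1 / delta)) = delta < 1 / 2]. *)
have lnd : 2^-1 <= ln (1 / delta).
  have := expR_ge1Dx (- ln (1 / delta)).
  by rewrite expRN lnK ?posrE ?divr_gt0// div1r invrK; lra.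
have l2 : l ^+ 2 = ln (1 / delta) by rewrite sqr_sqrtr//; lra.
have l_ge : 2^-1 <= l.
  have : 0 <= l by exact: sqrtr_ge0.
  by move: lnd; rewrite -l2; nra.
have l0 : 0 < l by lra.
have eta0 : 0 < eta by rewrite divr_gt0 ?mulr_gt0.
have G0 : 0 < G by rewrite divr_gt0 ?mulr_gt0.
have lam0 : 0 < lam by rewrite divr_gt0 ?mulr_gt0.
have [etaG lamG kappaL] := clipped_sgd_parameters L0 r0 tau0 l_ge.
(* This slack in the norm of the minimizer costs [L * r / tau] in risk, within the target order. *)
have e0 : 0 < r / tau by rewrite divr_gt0.
have [y [Xy yr Fy]] := near_minimizer_in_ball clX cvX L0 r0 inst X0 e0.
have Xx t w : X (x t w) by exact: iterate_in_domain.
have [Xxbar jensen] : (forall w, X (xbar w)) /\ (forall w, risk f P (xbar w) <=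
    T%:R^-1 * \sum_(0 <= t < T) risk f P (x t w)).
  by split=> w; have [] := jensen_average cvX (risk_convex cvX inst) T0 (Xx ^~ w).
set bound := 15 * _ * _.
set E := [set w | _].
have mE : measurable E.
  rewrite -[X in measurable X]setTI /E -preimage_true.
  apply: measurable_fun_ler => //; apply: measurable_funB => //.
  apply: (measurable_risk clX cvX L0 inst Xxbar).
  apply: measurable_rVZ => //; apply: measurable_rV_sum => t.
  apply: (measurable_clipped_sgd eta clX cvX X0 (ltW r0) (ltW G0) _
    (s := fun i w => xi i w)) => [|i _]; last exact: measurable_funPT.
  exact: selection_measurable (SM_Lip_selection inst).
have QE : (Q (~` E) <= delta%:E)%E.
  have -> : delta = expR (T%:R * (3 * (l / tau) ^+ 2) - 4 * l ^+ 2).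
    have -> : T%:R * (3 * (l / tau) ^+ 2) - 4 * l ^+ 2 = - l ^+ 2.
      by rewrite -tau2; field; rewrite gt_eqF.
    by rewrite l2 expRN lnK ?posrE ?divr_gt0// div1r invrK.
  apply: (@le_trans _ _ _ _ _ (probability_regret_ge clX cvX X0 inst iidxi L0 r0
    eta0 G0 lam0 etaG lamG Xy yr (T := T) (b := 4 * l ^+ 2) (measurableC mE) _)).
    (* Outside [E] the averaged point has a large risk gap; by Jensen's inequality so has the sum
       over the iterates. *)
    move=> w /= /negP; rewrite -ltNge => H.
    have -> : lam * (r ^+ 2 / (2 * eta)) = l / 6.
      by rewrite /lam /eta -/tau; field; rewrite !gt_eqF.
    have sumE : \sum_(0 <= t < T) (risk f P (x t w) - risk f P y) =
        \sum_(0 <= t < T) risk f P (x t w) - tau ^+ 2 * risk f P y.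
      by rewrite sumrB sumr_const_nat subn0 -mulr_natl tau2.
    have sum_ge : tau ^+ 2 * risk f P (xbar w) <=
        \sum_(0 <= t < T) risk f P (x t w).
      by have := jensen w; rewrite tau2 mulrC ler_pdivlMr ?ltr0n// mulrC.
    have gap : tau ^+ 2 * (bound - L * (r / tau)) <=
        tau ^+ 2 * (risk f P (xbar w) - risk f P y).
      by rewrite ler_pM2l ?exprn_gt0//; move: H Fy; lra.
    have gapE : lam * (tau ^+ 2 * (bound - L * (r / tau))) = 5 * l ^+ 2 - l / 3.
      by rewrite /lam /bound -/l -/tau; field; rewrite !gt_eqF.
    (* The claim [4 * l ^+ 2 + l / 6 <= 5 * l ^+ 2 - l / 3] amounts to [l / 2 <= l ^+ 2]. *)
    apply: (@le_trans _ _ (5 * l ^+ 2 - l / 3)); first by nra.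
    rewrite -gapE ler_pM2l// (le_trans gap)// sumE mulrBr lerD2r.
    exact: sum_ge.
  by rewrite lee_fin ler_expR lerD2r ler_wpM2l.
have := probability_setC Q (measurableC mE); rewrite setCK => ->.
by rewrite EFinB leeB.
Qed.
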